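(* Let $\gamma$ be a strong composition. Then \begin{align*} G_{\gamma}(X;q,t)= & \sum_{\tau\in\mathrm{ST}(\gamma)} t^{\mathrm{coinv}(\tau)}q^{\mathrm{maj}(\tau)} \left( \prod_{\substack{u\in\widehat{\mathrm{dg}}(\gamma)\\ u\notin W(\tau)}} \frac{1-t}{1-q^{\mathrm{leg}(u)+1}t^{\mathrm{arm}(u)+1}} \right) \\ &\times \sum_{U \subseteq W(\tau)} (-t)^{|U|} \left( \prod_{u \in U} \frac{1-q^{\mathrm{leg}(u)+1}t^{\mathrm{arm}(u)}}{1-q^{\mathrm{leg}(u)+1}t^{\mathrm{arm}(u)+1}} \right)F_{V(\tau)\cup U}. \end{align*}
   Context: Compositions and diagrams. A strong composition $\gamma=(\gamma_1,\dots,\gamma_\ell)$ of $n=|\gamma|=\sum_i\gamma_i$ is a finite list of positive integers. $\mathrm{inc}(\gamma)$ is the list obtained by sorting the parts of $\gamma$ in weakly increasing order. $\beta(\gamma)$ is the permutation $\sigma\in S_\ell$ of greatest length (number of inversions of its one-line word) with $\gamma_{\sigma_j}=\mathrm{inc}(\gamma)_j$ for all $j$; i.e. its one-line word lists the positions of the parts of $\gamma$ in weakly increasing order of part size, positions of equal parts being listed in decreasing order. For a composition $\alpha$, the diagram $\mathrm{dg}(\alpha)$ has $\alpha_i$ cells in column $i$ (columns numbered left to right, bottom-justified, rows numbered from bottom to top starting at 1); cell $(r,c)$ is in row $r$, column $c$. All tableaux attached to $\gamma$ are fillings of $\mathrm{dg}(\mathrm{inc}(\gamma))$, and $\widehat{\mathrm{dg}}(\gamma)$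 denotes the set of cells of $\mathrm{dg}(\mathrm{inc}(\gamma))$ not in the bottom row. A filling $T$ assigns a positive integer $T(u)$ to every cell $u$; $x^T=\prod_u x_{T(u)}$. $\mathrm{South}(u)$ is the cell directly below $u$. Statistics. In the diagram of $\alpha=\mathrm{inc}(\gamma)$: $\mathrm{leg}(u)$ is the number of cells above $u$ in its column; for $u=(r,i)$, the arm of $u$ consists of the cells $(r,j)\in\mathrm{dg}(\alpha)$ with $j>i$, $\alpha_j\le\alpha_i$ and the cells $(r-1,j)\in\mathrm{dg}(\alpha)$ with $j<i$, $\alpha_j<\alpha_i$, and $\mathrm{arm}(u)$ is its cardinality. $\mathrm{Des}(T)=\{u\in\widehat{\mathrm{dg}}(\gamma): T(u)>T(\mathrm{South}(u))\}$ and $\mathrm{maj}(T)=\sum_{u\in\mathrm{Des}(T)}(\mathrm{leg}(u)+1)$. A triple consists of a cell $x\in\widehat{\mathrm{dg}}(\gamma)$, the cell $y=\mathrm{South}(x)$, and a cell $z$ in the arm of $x$ (type A if $z$ is in the row of $x$, type B if $z$ is in the row of $y$). It is a coinversion triple if the entries strictly increase cyclically clockwise (type A) or counterclockwise (type B); in both types this means $T(x)<T(z)<T(y)$ or $T(z)<T(y)<T(x)$ or $T(y)<T(x)<T(z)$. $\mathrm{coinv}(T)$ is the number of coinversion triples. Non-attacking fillings and $G_\gamma$. Two distinct cells attack each other if they are in the same row, or if they are in adjacent rows and the one in the upper row is in a column strictly to the right of the one in the lower row. $T$ is non-attacking if $T(u)\ne T(v)$ for all attacking pairs $u,v$. $\mathrm{NAT}(\gamma)$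 is the set of non-attacking fillings of $\mathrm{dg}(\mathrm{inc}(\gamma))$ whose bottom row, read left to right, is order-equivalent to $\beta(\gamma)$. For $T\in\mathrm{NAT}(\gamma)$, $$\mathrm{wt}(T)= q^{\mathrm{maj}(T)}t^{\mathrm{coinv}(T)} \prod_{\substack{u \in \widehat{\mathrm{dg}}(\gamma)\\ T(u) \neq T(\mathrm{South}(u))}} \frac{1-t}{1-q^{\mathrm{leg}(u)+1}t^{\mathrm{arm}(u)+1}}.$$ The quasisymmetric Macdonald polynomial is the formal power series in $X=\{x_1,x_2,\dots\}$ given by $G_\gamma(X;q,t)=\sum_{T\in\mathrm{NAT}(\gamma)}\mathrm{wt}(T)\,x^T$. Standard fillings. $\mathrm{ST}(\gamma)$ is the set of fillings $\tau$ of $\mathrm{dg}(\mathrm{inc}(\gamma))$ using each of $1,\dots,n$ exactly once, whose bottom row, read left to right, is order-equivalent to $\beta(\gamma)$. For $\tau\in\mathrm{ST}(\gamma)$ cells are identified with their entries. Reading order reads rows from top to bottom and left to right within each row. $\mathrm{ID}(\tau)$ is the set of $i\in[n-1]$ such that $i+1$ precedes $i$ in reading order. $V(\tau)$ is the set of $i\in[n-1]$ such that $i\in\mathrm{ID}(\tau)$ or $i$ and $i+1$ are in cells attacking each other. $W(\tau)$ is the set of entries $i$ such that $i+1$ is in the cell directly below the cell of $i$. Fundamental quasisymmetric functions. For $S\subseteq[n-1]$, $F_S=\sum x_{i_1}x_{i_2}\cdots x_{i_n}$, the sum over all $1\le i_1\le i_2\le\cdots\le i_n$ such that $i_j\ne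 i_{j+1}$ whenever $j\in S$. *)

(* Defs.v *)
From HB Require Import structures.
From mathcomp Require Import all_boot all_order all_algebra all_fingroup.
From mathcomp Require Import finmap.
From mathcomp Require Import boolp classical_sets functions cardinality fsbigop.
From mathcomp Require Import monalg.

Set Implicit Arguments.
Unset Strict Implicit.
Unset Printing Implicit Defensive.

Import GRing.Theory.
Local Open Scope ring_scope.

(* The field Q(q,t): the inner polynomial variable is q, the outer one is t. *)
Definition Qqt : fieldType := {fraction {poly {poly rat}}}.
Definition q : Qqt := tofrac (polyC 'X).
Definition t : Qqt := tofrac 'X.

(* Formal power series in x_1, x_2, ..., as their coefficient functions on the
   monomials; the regular module Qqt^o gives them their Qqt-module structure.
   The variables are indexed by nat, but only positive indices are used. *)
Definition series := {cmonom nat} -> Qqt^o.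

Definition monom (I : finType) (f : I -> nat) : {cmonom nat} :=
  \big[mmul/mone]_(i : I) ucm (f i).

(* The formal sum of the w i * x^(mon i) for i in A. Finitely supported sums
   suffice, since each monomial occurs for finitely many i in all uses below
   (lemma monom_fiber_finite). *)
Definition formal_sum (I : choiceType) (A : set I) (w : I -> Qqt)
    (mon : I -> {cmonom nat}) : series :=
  fun m => \sum_(i \in (A `&` [set i | mon i = m])%classic) w i.

Section Compositions.
Local Open Scope nat_scope.

Definition strong_composition (gamma : seq nat) : bool :=
  all (fun k => 0 < k) gamma.

Definition inc (gamma : seq nat) : seq nat := sort leq gamma.

Definition sorting_perm (gamma : seq nat) (s : 'S_(size gamma)) : bool :=
  [forall j, nth 0 gamma (s j) == nth 0 (inc gamma) j].

Definition perm_length (l : nat) (s : 'S_l) : nat :=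
  #|[set p : 'I_l * 'I_l | (p.1 < p.2) && (s p.2 < s p.1)]|.

(* The default value 1 is irrelevant, see betaP. *)
Definition beta (gamma : seq nat) : 'S_(size gamma) :=
  [arg max_(s > (1%g : 'S_(size gamma)) | sorting_perm s) perm_length s].

End Compositions.

(* Rows and columns are numbered from 0: the bottom row is row 0. *)
Section Diagram.
Variable gamma : seq nat.
Local Open Scope nat_scope.

Definition height (c : nat) : nat := nth 0 (inc gamma) c.

Definition cell : finType := {c : 'I_(size gamma) & 'I_(height c)}.

Definition col (u : cell) : 'I_(size gamma) := tag u.
Definition row (u : cell) : nat := tagged u.

(* Outside the bottom row, the cell directly below u; on the bottom row, u. *)
Definition south (u : cell) : cell :=
  Tagged (fun c : 'I_(size gamma) => 'I_(height c))
    (Ordinal (leq_ltn_trans (leq_pred (tagged u)) (ltn_ord (tagged u)))).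

Definition dghat : {set cell} := [set u | row u != 0].

Definition leg (u : cell) : nat :=
  #|[set v | (col v == col u) && (row u < row v)]|.

Definition arm_set (u : cell) : {set cell} :=
  [set v | [&& row v == row u, col u < col v & height (col v) <= height (col u)]
        || [&& (row v).+1 == row u, col v < col u
             & height (col v) < height (col u)]].

Definition arm (u : cell) : nat := #|arm_set u|.

Definition attacks_from_above (u v : cell) : bool :=
  (row u == (row v).+1) && (col v < col u).

Definition attack (u v : cell) : bool :=
  (u != v) &&
  [|| row u == row v, attacks_from_above u v | attacks_from_above v u].

Definition reads_before (u v : cell) : bool :=
  (row v < row u) || ((row u == row v) && (col u < col v)).

Definition filling := {ffun cell -> nat}.

Implicit Type T : filling.

Definition Des T : {set cell} := [set u in dghat | T (south u) < T u].

Definition maj T : nat := \sum_(u in Des T) (leg u).+1.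

Definition coinv T : nat :=
  #|[set p : cell * cell |
      let: (x, z) := p in let y := south x in
      [&& x \in dghat, z \in arm_set x
        & [|| T x < T z < T y, T z < T y < T x | T y < T x < T z]]]|.

Definition bottom_row_like_beta T : bool :=
  [forall u, forall v, (row u == 0) && (row v == 0) ==>
    ((T u < T v) == (beta gamma (col u) < beta gamma (col v)))].

Definition nonattacking T : bool :=
  [forall u, forall v, attack u v ==> (T u != T v)].

Definition NAT : set filling :=
  [set T : filling | [&& [forall u, 0 < T u], nonattacking T
                       & bottom_row_like_beta T]]%classic.

Definition ST : set filling :=
  [set T : filling | perm_eq (codom T) (iota 1 (sumn gamma))
                     && bottom_row_like_beta T]%classic.

(* For tau in ST gamma, these are subsets of [n-1], n = sumn gamma. *)
Definition ID (tau : filling) : {pred nat} :=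
  [pred i | [exists u, exists v,
    [&& tau u == i, tau v == i.+1 & reads_before v u]]].

Definition V (tau : filling) : {pred nat} :=
  [pred i | (i \in ID tau) || [exists u, exists v,
    [&& tau u == i, tau v == i.+1 & attack u v]]].

(* W(tau), as a set of cells instead of entries. *)
Definition W (tau : filling) : {set cell} :=
  [set u in dghat | tau (south u) == (tau u).+1].

End Diagram.

Definition wt (gamma : seq nat) (T : filling gamma) : Qqt :=
  q ^+ maj T * t ^+ coinv T *
  \prod_(u in dghat gamma | T u != T (south u))
     ((1 - t) / (1 - q ^+ (leg u).+1 * t ^+ (arm u).+1)).

Definition G (gamma : seq nat) : series :=
  formal_sum (@NAT gamma) (@wt gamma) (fun T => monom T).

(* Only the elements of S between 1 and n-1 matter; s j is the index i_(j+1). *)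
Definition F (n : nat) (S : {pred nat}) : series :=
  formal_sum
    [set s : {ffun 'I_n -> nat} |
       (forall j, 0 < s j)%N /\
       (forall j k : 'I_n, k = j.+1 :> nat ->
          (s j <= s k)%N /\ (j.+1 \in S -> s j != s k))]%classic
    (fun=> 1) (fun s => monom s).

Section Facts.

Lemma sorting_perm_exists (gamma : seq nat) :
  exists s : 'S_(size gamma), sorting_perm s.
Proof.
have sz : size (inc gamma) == size gamma by rewrite size_sort.
have /tuple_permP[s def_s] : perm_eq (Tuple sz) (in_tuple gamma).
  by rewrite /= perm_sort.
exists s; apply/forallP => j; apply/eqP; rewrite [inc gamma]def_s.
by rewrite (nth_map j) ?size_enum_ord // nth_ord_enum (tnth_nth 0%N).
Qed.

Lemma betaP (gamma : seq nat) :
  sorting_perm (beta gamma) /\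
  forall s : 'S_(size gamma), sorting_perm s ->
    (perm_length s <= perm_length (beta gamma))%N.
Proof.
have [s0 s0P] := sorting_perm_exists gamma.
rewrite /beta; case: (arg_maxnP (@perm_length _) s0P) => s sP smax.
suff -> : [arg max_(s > (1%g : 'S_(size gamma)) | sorting_perm s)
             perm_length s] = [arg max_(s > s0 | sorting_perm s)
             perm_length s] by case: arg_maxnP.
rewrite /arg_max /extremum; case: pickP => // /(_ s) /=.
rewrite sP /=; move/negbT/negP; case.
by apply/forallP => s'; apply/implyP/smax.
Qed.

Lemma monomE (I : finType) (f : I -> nat) (k : nat) :
  monom f k = #|[set i | f i == k]|.
Proof.
rewrite /monom -sum1_card (big_morph (fun m : {cmonom nat} => m k)
  (fun m1 m2 => cmM k m1 m2) (cm1 k)).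
by rewrite [RHS]big_mkcond; apply: eq_bigr => i _; rewrite cmU inE; case: eqP.
Qed.

Lemma monom_fiber_finite (I : finType) (m : {cmonom nat}) :
  finite_set [set f : {ffun I -> nat} | monom f = m]%classic.
Proof.
pose N := (\max_(k <- finsupp m) k).+1.
apply: (@sub_finite_set _ _
  [set finfun (fun i => nat_of_ord (g i)) | g in [set: {ffun I -> 'I_N}]]%classic).
  move=> f /= fm.
  have lt_f i : (f i < N)%N.
    rewrite ltnS; apply: (leq_bigmax_seq (F := id)) => //.
    rewrite mem_finsupp -fm monomE -lt0n card_gt0.
    by apply/set0Pn; exists i; rewrite inE.
  exists [ffun i => Ordinal (lt_f i)] => //.
  by apply/ffunP => i; rewrite !ffunE.
exact/finite_image/finite_finset.
Qed.

Lemma ST_finite (gamma : seq nat) : finite_set (@ST gamma).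
Proof.
pose N := (sumn gamma).+1.
apply: (@sub_finite_set _ _
  [set finfun (fun i => nat_of_ord (g i)) | g in
     [set: {ffun cell gamma -> 'I_N}]]%classic).
  move=> f /= /andP[/perm_mem fm _].
  have lt_f i : (f i < N)%N.
    by have := fm (f i); rewrite codom_f mem_iota add1n; case: (_ < _)%N; rewrite ?andbF.
  exists [ffun i => Ordinal (lt_f i)] => //.
  by apply/ffunP => i; rewrite !ffunE.
exact/finite_image/finite_finset.
Qed.

End Facts.

(* Main.v *)
(* Every nonattacking filling T has a standardization: its cells are labelled
   1, ..., n by increasing value, equal values being labelled in reading order.
   The cells read after u and before a cell attacking u, or before the cell below
   u, all attack u; so in a nonattacking filling, equal entries in u and the cell
   below u must be consecutive in reading order among the entries of that value.
   Hence the fillings with standardization tau correspond to the weakly increasing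
   sequences that are strict on V(tau), maj and coinv are preserved, and
   T(u) = T(south u) forces u to be in W(tau). For fixed T the sum over U, which is
   restricted to the u in W(tau) with T(u) <> T(south u), factors into
     1 - t (1 - x) / (1 - t x) = (1 - t) / (1 - t x),  x = q^(leg+1) t^arm,
   which supplies the factors of wt(T) missing from the product over u notin W. *)

From mathcomp Require Import all_boot all_order all_algebra finmap.
From mathcomp Require Import boolp classical_sets functions cardinality fsbigop.
From mathcomp Require Import zify ring monalg.
Require Import Defs.

Set Implicit Arguments.
Unset Strict Implicit.
Unset Printing Implicit Defensive.

Import GRing.Theory.

(** Recovers a label of a standard filling from the number of smaller labels. *)
Lemma count_ltn_iota m n k : m <= k <= m + n -> count (ltn^~ k) (iota m n) = k - m.
Proof.
elim: n m => [|n IHn] m /= le_k; first lia.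
by have [lt_mk|ge_mk] := ltnP m k; [rewrite IHn; lia|];
  rewrite (eq_in_count (a2 := pred0)) ?count_pred0; [lia|move=> i; rewrite mem_iota /=; lia].
Qed.

Section Standardization.
Local Open Scope nat_scope.
Variable gamma : seq nat.
Local Notation cell := (cell gamma).
Local Notation filling := (filling gamma).
Implicit Types (u v w : cell) (T tau : filling).

(** * Reading order and attacking cells *)

Lemma cell_eq u v : col u = col v -> row u = row v -> u = v.
Proof.
case: u v => [c i] [d j]; rewrite /col /row /= => eq_cd.
by case: d / eq_cd j => j eq_ij; congr Tagged; apply/val_inj.
Qed.

Lemma col_south u : col (south u) = col u.
Proof. by []. Qed.

Lemma row_south u : row (south u) = (row u).-1.
Proof. by []. Qed.

Lemma card_cell : #|{: cell}| = sumn gamma.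
Proof.
rewrite card_tagged sumnE big_map big_enum /=.
under eq_bigr do rewrite card_ord.
rewrite -(big_mkord xpredT (fun i => height gamma i)) -(size_sort leq).
by rewrite -(big_nth 0 xpredT id) (perm_big gamma) ?perm_sort // sumnE.
Qed.

Lemma reads_before_trans : transitive (@reads_before gamma).
Proof. by move=> v u w; rewrite /reads_before; lia. Qed.

Lemma reads_before_irr : irreflexive (@reads_before gamma).
Proof. by move=> u; rewrite /reads_before; lia. Qed.

Lemma reads_before_total u v : u != v -> reads_before u v || reads_before v u.
Proof.
move=> neq_uv; suff: (row u != row v) || (col u != col v :> nat).
  by rewrite /reads_before; lia.
rewrite -negb_and; apply: contra neq_uv => /andP[/eqP ? /eqP ?].
by apply/eqP/cell_eq => //; apply: val_inj.
Qed.

Lemma attackC : symmetric (@attack gamma).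
Proof. by move=> u v; rewrite /attack eq_sym (eq_sym (row u)) [X in _ || X]orbC. Qed.

Lemma south_reads_after u : u \in dghat gamma -> reads_before u (south u).
Proof. by rewrite inE /reads_before row_south; lia. Qed.

(** Such a [w] lies in the row of [u], or one row lower and strictly left of [v], hence strictly
    left of [u]. *)
Lemma attack_between u v w : reads_before u w -> reads_before w v ->
  attack u v \/ (u \in dghat gamma /\ v = south u) -> attack u w.
Proof.
move=> uw wv uv; rewrite /attack; apply/andP; split.
  by apply: contraL uw => /eqP->; rewrite reads_before_irr.
case: uv => [/andP[_]|[]].
  by move: uw wv; rewrite /attacks_from_above /reads_before; lia.
rewrite inE => u0 v_def; move: uw wv; rewrite v_def /attacks_from_above /reads_before.
by rewrite row_south col_south; lia.
Qed.

(** * Standardization of a filling *)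

Definition std_lt T u v : bool := (T u < T v) || ((T u == T v) && reads_before u v).

Definition std T : filling := [ffun u => #|[set v | std_lt T v u]|.+1].

Lemma std_lt_irr T : irreflexive (std_lt T).
Proof. by move=> u; rewrite /std_lt reads_before_irr; lia. Qed.

Lemma std_lt_neq T u v : T u != T v -> std_lt T u v = (T u < T v).
Proof. by rewrite /std_lt => /negPf->; rewrite orbF. Qed.

Lemma std_lt_trans T : transitive (std_lt T).
Proof.
move=> v u w; rewrite /std_lt; have := @reads_before_trans v u w; lia.
Qed.

Lemma std_lt_total T u v : u != v -> std_lt T u v || std_lt T v u.
Proof. by move=> /reads_before_total; rewrite /std_lt; lia. Qed.

(** Labels count predecessors in the strict total order [std_lt], and a smaller cell has a strictly
    smaller set of predecessors. *)
Lemma std_ltE T u v : (std T u < std T v) = std_lt T u v.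
Proof.
have std_mono x y : std_lt T x y -> std T x < std T y.
  move=> xy; rewrite !ffunE ltnS; apply/proper_card/properP; split.
    by apply/fintype.subsetP => w; rewrite !inE => /std_lt_trans; apply.
  by exists x; rewrite !inE // std_lt_irr.
apply/idP/idP; last exact: std_mono.
apply: contraLR => n_uv; rewrite -leqNgt.
have [->//|/(std_lt_total T)] := eqVneq u v.
by rewrite (negPf n_uv) => /std_mono/ltnW.
Qed.

Lemma std_inj T : injective (std T).
Proof.
move=> u v eq_uv; apply/eqP/negP => /negP /(std_lt_total T).
by rewrite -!std_ltE eq_uv ltnn.
Qed.

Definition standard tau := perm_eq (codom tau) (iota 1 (sumn gamma)).

Lemma standard_inj tau : standard tau -> injective tau.
Proof. by move/perm_uniq; rewrite iota_uniq => /injectiveP. Qed.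

Lemma standard_bound tau u : standard tau -> 0 < tau u <= sumn gamma.
Proof. by move/perm_mem/(_ (tau u)); rewrite codom_f mem_iota; lia. Qed.

Lemma standard_surj tau k : standard tau -> 0 < k <= sumn gamma -> exists u, tau u = k.
Proof.
move/perm_mem/(_ k); rewrite mem_iota => in_k le_k.
by have /codomP[u ->] : k \in codom tau; [rewrite in_k; lia|exists u].
Qed.

Lemma standard_next tau u v : standard tau -> tau u < tau v ->
  exists w, tau w = (tau u).+1.
Proof.
move=> st uv; apply: standard_surj => //.
by have := standard_bound v st; lia.
Qed.

Lemma std_standard T : standard (std T).
Proof.
have uniq_std : uniq (codom (std T)) by apply/injectiveP; apply: std_inj.
have [||_ eqi] := @uniq_min_size _ (codom (std T)) (iota 1 (sumn gamma)) uniq_std.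
- move=> _ /codomP[u ->]; rewrite mem_iota ffunE add1n !ltnS /=.
  (* [u] is not its own predecessor, so the complement of its set of predecessors is nonempty and
     its label is at most the number of cells. *)
  rewrite -card_cell -(cardsC [set v | std_lt T v u]) -addn1 leq_add2l card_gt0.
  by apply/set0Pn; exists u; rewrite !inE std_lt_irr.
- by rewrite size_iota size_codom card_cell.
- by apply: uniq_perm; rewrite ?iota_uniq.
Qed.

Lemma std_unique T tau : standard tau ->
  (forall u v, (tau u < tau v) = std_lt T u v) -> std T = tau.
Proof.
move=> st lt_tau; apply/ffunP => u; rewrite ffunE.
have -> : #|[set v | std_lt T v u]| = count (ltn^~ (tau u)) (codom tau).
  rewrite count_map enumT cardE size_filter; apply: eq_count => v.
  by rewrite /= inE -lt_tau.
rewrite (permP st) count_ltn_iota; have := standard_bound u st; lia.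
Qed.

(** * Bottom row and statistics under standardization *)

Lemma nonattacking_row0_inj T u v : nonattacking T ->
  row u = 0 -> row v = 0 -> T u = T v -> u = v.
Proof.
move=> naT u0 v0 eqT; have := implyP (forallP (forallP naT u) v).
have [//|neq_uv] := eqVneq u v.
by rewrite /attack neq_uv u0 v0 => /(_ isT); rewrite eqT eqxx.
Qed.

Lemma bottom_row_std T : nonattacking T ->
  bottom_row_like_beta (std T) = bottom_row_like_beta T.
Proof.
move=> naT; apply: eq_forallb => u; apply: eq_forallb => v.
have [/andP[/eqP u0 /eqP v0]/=|//] := boolP (_ && _).
rewrite std_ltE /std_lt; have [eqT|] := eqVneq (T u) (T v); last by rewrite orbF.
by rewrite (nonattacking_row0_inj naT u0 v0 eqT) reads_before_irr orbF.
Qed.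

Lemma std_ST T : NAT T -> ST (std T).
Proof.
case/and3P=> _ naT brT; apply/andP; split; first exact: std_standard.
by rewrite bottom_row_std.
Qed.

(** Otherwise the cell labelled next after [u] would carry the same value and be read between [u]
    and [v], so it would attack [u]. *)
Lemma std_consecutive T u v : nonattacking T -> T u = T v -> reads_before u v ->
  attack u v \/ (u \in dghat gamma /\ v = south u) -> std T v = (std T u).+1.
Proof.
move=> naT eqT uv near.
have lt_uv : std T u < std T v by rewrite std_ltE /std_lt eqT eqxx uv orbT.
have [w wE] := standard_next (std_standard T) lt_uv.
have uw : std_lt T u w by rewrite -std_ltE wE.
have [<-//|neq_vw] := eqVneq w v.
have wv : std_lt T w v.
  by case/orP: (std_lt_total T neq_vw) => //; rewrite -std_ltE; lia.
have [eq_w r_uw r_wv] : [/\ T u = T w, reads_before u w & reads_before w v].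
  by move: uw wv; rewrite /std_lt => uw wv; split; lia.
have := attack_between r_uw r_wv near.
by move=> /(implyP (forallP (forallP naT u) w)); rewrite eq_w eqxx.
Qed.

Lemma std_south T u : nonattacking T -> u \in dghat gamma -> T u = T (south u) ->
  std T (south u) = (std T u).+1.
Proof.
by move=> naT u1 eqT; apply: std_consecutive => //; [exact: south_reads_after|right].
Qed.

(** A tie between [u] and [south u] is no descent of [T], nor of [std T], since [u] is read first
    and gets the smaller label. *)
Lemma Des_std T : Des (std T) = Des T.
Proof.
apply/setP => u; rewrite !inE; have [u1|//] := boolP (row u != 0); rewrite /=.
rewrite std_ltE /std_lt; have [eqT|] := eqVneq (T (south u)) (T u); last by rewrite orbF.
rewrite /reads_before row_south col_south eqT !ltnn andbF orbF /=.
by apply/negbTE; rewrite -leqNgt; lia.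
Qed.

Lemma maj_std T : maj (std T) = maj T.
Proof. by rewrite /maj Des_std. Qed.

Lemma arm_attack u v : u \in dghat gamma -> v \in arm_set u ->
  attack v u && attack v (south u).
Proof.
rewrite !inE => u1 arm_v; rewrite /attack /attacks_from_above row_south col_south.
have ne (w : cell) : col w = col u -> v != w.
  move=> eq_col; apply/eqP => vE; move: arm_v; rewrite vE eq_col; lia.
by rewrite !ne //=; lia.
Qed.

(** An arm cell attacks both [x] and [south x], so its entry ties with neither. If those two tie,
    their labels are consecutive with the larger one below, and neither filling has a coinversion
    triple there. *)
Lemma coinv_std T : nonattacking T -> coinv (std T) = coinv T.
Proof.
move=> naT; pose cyc (f : filling) x z := let y := south x in
  [|| f x < f z < f y, f z < f y < f x | f y < f x < f z].
suff cyc_std x z : x \in dghat gamma -> z \in arm_set x -> cyc (std T) x z = cyc T x z.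
  apply: eq_card => -[x z]; rewrite inE [RHS]inE.
  by apply: andb_id2l => xhat; apply: andb_id2l; apply: cyc_std.
move=> xhat /(arm_attack xhat)/andP[az azs]; rewrite /cyc.
have := implyP (forallP (forallP naT z) x) az.
have := implyP (forallP (forallP naT z) (south x)) azs.
have [eqT|ne_xy] := eqVneq (T x) (T (south x)) => ne_zy ne_zx.
  rewrite (std_south naT xhat eqT).
  by apply/idP/idP => ?; lia.
by rewrite !std_ltE !std_lt_neq // eq_sym.
Qed.

(** * Fillings as weakly increasing sequences *)

(** The index sequences of [F] carried over to cells: [T u] is the index at position [tau u]. *)
Definition increasing (S : {pred nat}) tau T := (forall u, 0 < T u) /\
  forall u v, tau v = (tau u).+1 -> T u <= T v /\ (tau u \in S -> T u != T v).

(** A tie between consecutive labels is possible only when the second cell is read later, which is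
    the tie-breaking rule of [std_lt]. *)
Lemma increasing_next tau T u v : increasing (ID tau) tau T ->
  tau v = (tau u).+1 -> std_lt T u v.
Proof.
move=> [_ incT] vE; have [le_uv neq_uv] := incT u v vE; rewrite /std_lt.
have [eqT|] := eqVneq (T u) (T v); last lia.
have /reads_before_total : u != v by apply/eqP=> uv; move: vE; rewrite uv; lia.
case/orP=> [->|vu]; first by rewrite orbT.
have : tau u \in ID tau.
  by apply/existsP; exists u; apply/existsP; exists v; rewrite eqxx vu vE eqxx.
by move/neq_uv; rewrite eqT eqxx.
Qed.

Lemma increasing_lt tau T u v : standard tau -> increasing (ID tau) tau T ->
  tau u < tau v -> std_lt T u v.
Proof.
move=> st incT; move Ek: (tau v - (tau u).+1) => k.
elim: k u Ek => [|k IHk] u Ek uv; first by apply: (increasing_next incT); lia.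
have [w wE] := standard_next st uv.
by apply: std_lt_trans (increasing_next incT wE) _; apply: IHk; lia.
Qed.

Lemma increasing_std tau T : standard tau -> increasing (ID tau) tau T -> std T = tau.
Proof.
move=> st incT; apply: std_unique => // u v; apply/idP/idP.
  exact: increasing_lt.
move=> uv; rewrite ltnNge leq_eqVlt negb_or; apply/andP; split.
  by apply: contraTneq uv => /(standard_inj st)->; rewrite std_lt_irr.
by apply/negP => /(increasing_lt st incT)/(std_lt_trans uv); rewrite std_lt_irr.
Qed.

Lemma increasing_sub (S1 S2 : {pred nat}) tau T : {subset S1 <= S2} ->
  increasing S2 tau T -> increasing S1 tau T.
Proof. by move=> S12 [pos inc2]; split=> // u v /inc2[le ne]; split=> // /S12. Qed.

Lemma ID_V tau : {subset ID tau <= V tau}.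
Proof. by move=> i iID; rewrite /V inE iID. Qed.

(** Suppose [T] ties on attacking cells [u] and [v]. The cell labelled next after [u] has the same
    value and is [v] or is read between them, so it attacks [u]. This puts [tau u] in [V tau], where
    a tie is forbidden. *)
Lemma increasing_V_nonattacking tau T : standard tau ->
  increasing (V tau) tau T -> nonattacking T.
Proof.
move=> st incT.
have stdT : std T = tau.
  by apply: increasing_std => //; apply: increasing_sub (@ID_V tau) incT.
suff wl u v : attack u v -> reads_before u v -> T u != T v.
  apply/forallP => u; apply/forallP => v; apply/implyP => uv.
  have /andP[/reads_before_total/orP[] /wl ru _] := uv; first exact: ru.
  by rewrite eq_sym ru // attackC.
move=> uv r_uv; apply/eqP => eqT.
have lt_uv : tau u < tau v by rewrite -stdT std_ltE /std_lt eqT eqxx r_uv orbT.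
have [w wE] := standard_next st lt_uv.
have uw : std_lt T u w by rewrite -std_ltE stdT wE.
have wv : w = v \/ std_lt T w v.
  have [->|/(std_lt_total T)/orP[]] := eqVneq w v; [by left|by right|].
  by rewrite -std_ltE stdT; lia.
have [eq_w r_uw] : T u = T w /\ reads_before u w.
  by case: wv => [->//|wv]; move: uw wv; rewrite /std_lt; lia.
have att : attack u w.
  case: wv => [->//|wv]; apply: (attack_between r_uw _ (or_introl uv)).
  by move: wv; rewrite /std_lt; lia.
have [_ /(_ _)/negP[]] := incT.2 u w wE; last by rewrite eq_w.
rewrite /V inE; apply/orP; right.
by apply/existsP; exists u; apply/existsP; exists w; rewrite eqxx wE eqxx.
Qed.

Lemma increasing_VP tau T : ST tau ->
  increasing (V tau) tau T <-> NAT T /\ std T = tau.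
Proof.
case/andP=> st br; split.
  move=> incT; have naT := increasing_V_nonattacking st incT.
  have stdT : std T = tau.
    by apply: increasing_std => //; apply: increasing_sub (@ID_V tau) incT.
  split=> //; apply/and3P; split=> //; first exact/forallP/incT.1.
  by rewrite -bottom_row_std // stdT.
case=> /and3P[/forallP pos naT _] stdT; split=> // u v vE.
have uv : std_lt T u v by rewrite -std_ltE stdT vE.
split; first by move: uv; rewrite /std_lt; lia.
have tauI := standard_inj st.
(* If the next label is read earlier, a tie would have been labelled the other way round; if the two
   cells attack, [T] separates them by hypothesis. *)
rewrite /V /ID !inE => /orP[]/existsP[u' /existsP[v' /and3P[/eqP/tauI-> ]]].
  rewrite -vE => /eqP/tauI-> vu; apply/eqP => eqT; move: uv.
  rewrite /std_lt eqT ltnn eqxx /= => /reads_before_trans/(_ vu).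
  by rewrite reads_before_irr.
by rewrite -vE => /eqP/tauI->; apply/implyP/(forallP (forallP naT u)).
Qed.

(** For [u] in [W tau] the next label sits in [south u], so strictness at [tau u] means
    [T u != T (south u)]. *)
Lemma increasing_VU tau T (U : {set cell}) : ST tau -> U \subset W tau ->
  increasing [predU V tau & [seq tau u | u in U]] tau T <->
  [/\ NAT T, std T = tau & [forall u in U, T u != T (south u)]].
Proof.
move=> stau /fintype.subsetP subU; have /andP[st _] := stau.
have tauI := standard_inj st; split.
  move=> incT; have [|natT stdT] := (increasing_VP T stau).1.
    by apply: increasing_sub incT => i; rewrite !inE => ->.
  split=> //; apply/forallP => u; apply/implyP => uU.
  have /(_ u (south u)) := incT.2; have := subU u uU; rewrite inE => /andP[_ /eqP->].
  by case=> // _; apply; rewrite !inE fintype.image_f ?orbT.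
case=> natT stdT /forallP neU; have [pos incT] := (increasing_VP T stau).2 (conj natT stdT).
split=> // u v vE; have [le ne] := incT u v vE; split=> //.
rewrite !inE => /orP[/ne//|/fintype.imageP[u' uU /tauI uu']]; rewrite -uu' in uU.
have -> : v = south u.
  by apply: tauI; have := subU u uU; rewrite vE inE => /andP[_ /eqP->].
exact: implyP (neU u) uU.
Qed.

End Standardization.

(** * Arithmetic in the field of q and t *)

Section Expansion.
Local Open Scope ring_scope.

(** At t = 0 the expression is 1, because the exponent of t is positive; t is the outer polynomial
    variable, so this is evaluation at 0. *)
Lemma one_sub_qt_neq0 a b : 1 - q ^+ a * t ^+ b.+1 != 0.
Proof.
rewrite /q /t -!tofracXn -tofracM -tofrac1 -tofracB tofrac_eq0.
apply/eqP => /(congr1 (fun p => p.[0])) /eqP.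
by rewrite hornerD hornerN hornerM hornerXn expr0n mulr0 subr0 hornerC horner0 oner_eq0.
Qed.

Lemma one_sub_ratio (K : fieldType) (y x : K) : 1 - x * y != 0 ->
  - y * ((1 - x) / (1 - x * y)) + 1 = (1 - y) / (1 - x * y).
Proof. by move=> nz; field. Qed.

Variable gamma : seq nat.
Local Notation cell := (cell gamma).
Local Notation filling := (filling gamma).
Implicit Types (u v : cell) (T tau : filling) (U : {set cell}).

(** * Fundamental quasisymmetric functions as sums over fillings *)

Lemma F_standard tau (S : {pred nat}) : standard tau ->
  F (sumn gamma) S =
  formal_sum [set T | increasing S tau T]%classic (fun=> 1) (fun T => monom T).
Proof.
move=> st; have tauI := standard_inj st.
(* [e j] is the cell labelled j+1, since positions in [F] start at 0 and labels at 1; [g] below is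
   its inverse. *)
have /choice[e eE] (j : 'I_(sumn gamma)) : exists u, tau u = j.+1.
  by apply: (standard_surj st); rewrite ltn_ord.
have lt_tau u : ((tau u).-1 < sumn gamma)%N by have := standard_bound u st; lia.
pose g u := Ordinal (lt_tau u).
have tau_g u : (tau u).-1.+1 = tau u by have := standard_bound u st; lia.
have gK : cancel g e by move=> u; apply: tauI; rewrite eE /= tau_g.
have eK : cancel e g by move=> j; apply: val_inj; rewrite /= eE.
pose h T : {ffun 'I_(sumn gamma) -> nat} := [ffun j => T (e j)].
have monom_h T : monom (h T) = monom T.
  rewrite /monom (reindex e) /=; last by exists g => ? _; [exact: eK|exact: gK].
  by apply: eq_bigr => j _; rewrite ffunE.
apply: funext => m; apply: (reindex_fsbig h); split.
- move=> T [[pos incT] Tm]; split; last by rewrite /= monom_h.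
  split=> [j|j k kE]; rewrite !ffunE //.
  by have := incT (e j) (e k); rewrite !eE kE; apply.
- move=> T1 T2 _ _ /ffunP hT; apply/ffunP => u.
  by have := hT (g u); rewrite !ffunE gK.
- move=> s [[pos incs] sm]; pose T : filling := [ffun u => s (g u)].
  have hT : h T = s by apply/ffunP => j; rewrite !ffunE eK.
  exists T => //; split; last by rewrite /= -monom_h hT.
  split=> [u|u v vE]; rewrite !ffunE //.
  by have := incs (g u) (g v); rewrite /= tau_g; apply; rewrite vE.
Qed.

Lemma monom_fillings_finite (A : set filling) m :
  finite_set (A `&` [set T | monom T = m])%classic.
Proof. by apply: (sub_finite_set _ (@monom_fiber_finite cell m)) => T []. Qed.

(** Fixing the monomial leaves finitely many fillings, so sums over them can be exchanged with other
    finite sums. *)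
Definition NAT_monom m : seq filling :=
  fset_set (@NAT gamma `&` [set T | monom T = m])%classic.

Lemma mem_NAT_monom m T : T \in NAT_monom m -> NAT T.
Proof. by rewrite in_fset_set ?inE; [case|exact: monom_fillings_finite]. Qed.

Lemma F_ST tau U m : ST tau -> U \subset W tau ->
  F (sumn gamma) [predU V tau & [seq tau u | u in U]] m =
  \sum_(T <- NAT_monom m | (std T == tau) && [forall u in U, T u != T (south u)]) 1.
Proof.
move=> stau subU; rewrite (@F_standard tau); last by case/andP: stau.
pose ok T := (std T == tau) && [forall u in U, T u != T (south u)].
transitivity (\sum_(T \in (@NAT gamma `&` [set T | monom T = m]) `&` ok) (1 : Qqt))%classic.
  apply: eq_fsbigl; apply/seteqP; split=> T.
    by move=> [/(increasing_VU T stau subU)[? /eqP ? ?] ?]; split=> //; apply/andP.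
  by move=> [[? ?] /andP[/eqP ? ?]]; split=> //; apply/(increasing_VU T stau subU).
rewrite fsbig_mkcondr fsbig_finite; last exact: monom_fillings_finite.
rewrite [RHS]big_mkcond /=; apply: eq_bigr => T _.
by congr (if _ then _ else _); apply/idP/idP; rewrite inE.
Qed.

(** * Weights and the sum over U *)

Definition ratio u : Qqt := (1 - t) / (1 - q ^+ (leg u).+1 * t ^+ (arm u).+1).

Lemma sum_prod_ratio (A : {set cell}) :
  \sum_(U : {set cell} | U \subset A)
    (- t) ^+ #|U| * \prod_(u in U)
      ((1 - q ^+ (leg u).+1 * t ^+ arm u) / (1 - q ^+ (leg u).+1 * t ^+ (arm u).+1))
  = \prod_(u in A) ratio u.
Proof.
pose f u : Qqt := - t * ((1 - q ^+ (leg u).+1 * t ^+ arm u)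
                  / (1 - q ^+ (leg u).+1 * t ^+ (arm u).+1)).
(* With 0 outside [A], expanding the product of [f' u + 1] over all cells leaves only the subsets of
   [A]. *)
pose f' u := if u \in A then f u else 0.
transitivity (\prod_u (f' u + 1)).
  rewrite bigA_distr [LHS]big_mkcond; apply: eq_bigr => U _.
  rewrite -big_mkcond; case: ifPn => [/fintype.subsetP subU|].
    rewrite -prodr_const -big_split /=; apply: eq_bigr => u /subU uA.
    by rewrite /f' uA.
  case/fintype.subsetPn => u uU /negPf uA.
  by rewrite (bigD1 u) //= /f' uA mul0r.
rewrite [RHS]big_mkcond; apply: eq_bigr => u _; rewrite /f' /f /ratio.
case: (u \in A); last exact: add0r.
have := @one_sub_ratio Qqt t (q ^+ (leg u).+1 * t ^+ arm u).
by rewrite -mulrA -exprSr; apply; apply: one_sub_qt_neq0.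
Qed.

(** Off [W (std T)] the condition [T u != T (south u)] holds automatically by [std_south]; on it,
    the remaining factors are expanded by [sum_prod_ratio]. *)
Lemma wt_std T : NAT T ->
  wt T = t ^+ coinv (std T) * q ^+ maj (std T) *
    \prod_(u in dghat gamma | u \notin W (std T)) ratio u *
    \sum_(U : {set cell} | (U \subset W (std T)) && [forall u in U, T u != T (south u)])
      (- t) ^+ #|U| * \prod_(u in U)
        ((1 - q ^+ (leg u).+1 * t ^+ arm u) / (1 - q ^+ (leg u).+1 * t ^+ (arm u).+1)).
Proof.
case/and3P=> _ naT _; rewrite coinv_std // maj_std /wt -!mulrA; set p := \prod_(_ in _ | _) _.
rewrite mulrCA; congr (_ * (_ * _)); rewrite {}/p.
rewrite (bigID (fun u => u \in W (std T))) /= mulrC; congr (_ * _).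
  apply: eq_bigl => u; rewrite -andbA; apply: andb_id2l => u1.
  apply/andP/idP => [[]//|uW]; split=> //.
  apply: contra uW => /eqP eqT; rewrite inE u1; apply/eqP.
  exact: std_south.
transitivity (\prod_(u in [set u in W (std T) | T u != T (south u)]) ratio u).
  apply: eq_bigl => u; rewrite [in RHS]inE andbC; apply: andb_id2l.
  by rewrite inE => /andP[-> _].
rewrite -sum_prod_ratio; apply: eq_bigl => U.
apply/fintype.subsetP/andP => [subU|[/fintype.subsetP subU /forallP neU] u uU].
  split; first by apply/fintype.subsetP => u /subU; rewrite inE => /andP[].
  by apply/forallP => u; apply/implyP => /subU; rewrite inE => /andP[].
by rewrite inE subU //; apply: implyP (neU u) uU.
Qed.

End Expansion.

(** * Comparison of coefficients, one monomial at a time *)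

Local Open Scope ring_scope.

Theorem theorem1p1 (gamma : seq nat) (hgamma : strong_composition gamma) :
  G gamma =
  \sum_(tau \in @ST gamma)
    (t ^+ coinv tau * q ^+ maj tau *
     \prod_(u in dghat gamma | u \notin W tau)
        ((1 - t) / (1 - q ^+ (leg u).+1 * t ^+ (arm u).+1))) *:
    \sum_(U : {set cell gamma} | U \subset W tau)
      ((- t) ^+ #|U| *
       \prod_(u in U)
          ((1 - q ^+ (leg u).+1 * t ^+ arm u)
           / (1 - q ^+ (leg u).+1 * t ^+ (arm u).+1))) *:
      F (sumn gamma) [predU V tau & [seq tau u | u in U]].
Proof.
have finST := ST_finite gamma.
apply: funext => m; rewrite [LHS]fsbig_finite; last exact: monom_fillings_finite.
rewrite fsbig_finite // fct_sumE -/(NAT_monom gamma m).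
(* Each nonattacking filling is counted once, under its own standardization. *)
transitivity (\sum_(tau <- fset_set (@ST gamma)) \sum_(T <- NAT_monom gamma m | std T == tau) wt T).
  rewrite (exchange_big_dep predT) //= big_seq [RHS]big_seq; apply: eq_bigr => T inT.
  have inST : std T \in fset_set (@ST gamma).
    by rewrite in_fset_set ?inE //; apply/std_ST/(mem_NAT_monom inT).
  rewrite big_mkcond (bigD1_seq (std T) inST (fset_uniq _)) /= eqxx big1 ?addr0 // => tau.
  by rewrite eq_sym => /negPf->.
rewrite big_seq [RHS]big_seq; apply: eq_bigr => tau.
rewrite in_fset_set ?inE // => stau.
rewrite fctE fct_sumE; set c := (X in X *: _).
transitivity (\sum_(T <- NAT_monom gamma m | std T == tau)
   \sum_(U : {set cell gamma} | (U \subset W tau) && [forall u in U, T u != T (south u)])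
     (c * ((- t) ^+ #|U| * \prod_(u in U)
        ((1 - q ^+ (leg u).+1 * t ^+ arm u) / (1 - q ^+ (leg u).+1 * t ^+ (arm u).+1))))).
  rewrite big_seq_cond [RHS]big_seq_cond; apply: eq_bigr => T /andP[inT /eqP stdT].
  by rewrite (wt_std (mem_NAT_monom inT)) stdT mulr_sumr.
(* For fixed [U] the summand no longer depends on [T], and the remaining fillings are those counted
   by the coefficient of [F] at the union of [V tau] and the labels of [U]. *)
rewrite (exchange_big_dep (fun U : {set cell gamma} => U \subset W tau)) /=; last first.
  by move=> T U _ /andP[].
rewrite scaler_sumr; apply: eq_bigr => U subU; rewrite fctE F_ST //.
rewrite scalerA /GRing.scale /= mulr_sumr; apply: eq_big => [T|T _]; first by rewrite subU.
by rewrite mulr1.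
Qed.
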